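(* Let $(M,\tilde\varphi,\xi,\eta,\tilde g)$ be a paracontact metric $(\tilde\kappa,\tilde\mu)$-manifold with $\tilde\kappa<-1$; assume the index of $\mathcal D_{\tilde\varphi\tilde h}(\pm\sqrt{-1-\tilde\kappa})$ is constant on $M$. Then its curvature tensor is given, for all vector fields $X,Y,Z,W$, by $$\begin{aligned}\tilde g(\tilde R_{XY}Z,W)=&\Bigl(-1+\tfrac{\tilde\mu}{2}\Bigr)\bigl(\tilde g(Y,Z)\tilde g(X,W)-\tilde g(X,Z)\tilde g(Y,W)\bigr)\\&+\tilde g(Y,Z)\tilde g(\tilde hX,W)-\tilde g(X,Z)\tilde g(\tilde hY,W)-\tilde g(Y,W)\tilde g(\tilde hX,Z)+\tilde g(X,W)\tilde g(\tilde hY,Z)\\&+\frac{-1+\frac{\tilde\mu}{2}}{\tilde\kappa+1}\bigl(\tilde g(\tilde hY,Z)\tilde g(\tilde hX,W)-\tilde g(\tilde hX,Z)\tilde g(\tilde hY,W)\bigr)\\&-\frac{\tilde\mu}{2}\bigl(\tilde g(\tilde\varphi Y,Z)\tilde g(\tilde\varphi X,W)-\tilde g(\tilde\varphi X,Z)\tilde g(\tilde\varphi Y,W)\bigr)\\&+\frac{-\tilde\kappa-\frac{\tilde\mu}{2}}{\tilde\kappa+1}\bigl(\tilde g(\tilde\varphi\tilde hY,Z)\tilde g(\tilde\varphi\tilde hX,W)-\tilde g(\tilde\varphi\tilde hY,W)\tilde g(\tilde\varphi\tilde hX,Z)\bigr)\\&+\tilde\mu\,\tilde g(\tilde\varphi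 X,Y)\tilde g(\tilde\varphi Z,W)\\&+\eta(X)\eta(W)\bigl((\tilde\kappa+1-\tfrac{\tilde\mu}{2})\tilde g(Y,Z)+(\tilde\mu-1)\tilde g(\tilde hY,Z)\bigr)\\&-\eta(X)\eta(Z)\bigl((\tilde\kappa+1-\tfrac{\tilde\mu}{2})\tilde g(Y,W)+(\tilde\mu-1)\tilde g(\tilde hY,W)\bigr)\\&+\eta(Y)\eta(Z)\bigl((\tilde\kappa+1-\tfrac{\tilde\mu}{2})\tilde g(X,W)+(\tilde\mu-1)\tilde g(\tilde hX,W)\bigr)\\&-\eta(Y)\eta(W)\bigl((\tilde\kappa+1-\tfrac{\tilde\mu}{2})\tilde g(X,Z)+(\tilde\mu-1)\tilde g(\tilde hX,Z)\bigr).\end{aligned}$$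
   Context: Conventions: $2d\eta(X,Y)=X(\eta(Y))-Y(\eta(X))-\eta([X,Y])$; $\tilde R_{XY}Z=\tilde\nabla_X\tilde\nabla_YZ-\tilde\nabla_Y\tilde\nabla_XZ-\tilde\nabla_{[X,Y]}Z$ with $\tilde\nabla$ the Levi-Civita connection of $\tilde g$. An almost paracontact structure on a $(2n+1)$-dimensional manifold $M$ is $(\tilde\varphi,\xi,\eta)$, with $\tilde\varphi$ a $(1,1)$-tensor field, $\xi$ a vector field, $\eta$ a 1-form, such that $\eta(\xi)=1$, $\tilde\varphi^2=I-\eta\otimes\xi$ and the $\pm1$-eigendistributions of $\tilde\varphi$ on $\mathcal D=\ker\eta$ both have dimension $n$. With a pseudo-Riemannian metric $\tilde g$ satisfying $\tilde g(\tilde\varphi X,\tilde\varphi Y)=-\tilde g(X,Y)+\eta(X)\eta(Y)$ and $d\eta(X,Y)=\tilde g(X,\tilde\varphi Y)$ it is a paracontact metric structure. Put $\tilde h=\frac12\mathcal L_\xi\tilde\varphi$. A paracontact metric $(\tilde\kappa,\tilde\mu)$-manifold ($\tilde\kappa,\tilde\mu$ real constants) is a paracontact metric manifold whose curvature tensor satisfies $\tilde R_{XY}\xi=\tilde\kappa(\eta(Y)X-\eta(X)Y)+\tilde\mu(\eta(Y)\tilde hX-\eta(X)\tilde hY)$ for all vector fields $X,Y$. When $\tilde\kappa<-1$, $\tilde\varphi\tilde h$ is diagonalizable with eigenvalues $0$ and $\pm\sqrt{-1-\tilde\kappa}$ (the latter of multiplicity $n$ each); $\mathcal D_{\tilde\varphi\tilde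 h}(\pm\sqrt{-1-\tilde\kappa})$ are the corresponding eigendistributions, and the index is that of the restriction of $\tilde g$. *)

(* Defs.v *)
(* Smooth manifolds carried by charts, and tensor calculus in the style of
   O'Neill's "Semi-Riemannian Geometry": vector fields are the derivations of
   the ring C^oo(M), and tensor fields are the C^oo(M)-multilinear maps on
   vector fields. By the usual bump-function arguments, every tangent vector at
   p is the value at p of a global vector field, and the value at p of a tensor
   depends only on the values of its arguments at p; the pointwise notions
   below (nondegeneracy, eigendistributions, dimension, index) rely on this. *)
From HB Require Import structures.
From mathcomp Require Import all_boot all_order all_algebra.
From mathcomp Require Import all_classical all_reals.
From mathcomp Require Import topology normedtype derive.
From mathcomp Require Import ring.
Set Implicit Arguments.
Unset Strict Implicit.
Unset Printing Implicit Defensive.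
Import Order.TTheory GRing.Theory Num.Theory.
Import numFieldNormedType.Exports.
Local Open Scope classical_set_scope.
Local Open Scope ring_scope.

Section SmoothRm.
Variables (R : realType) (m : nat).

Fixpoint Ck (W : normedModType R) (k : nat) (U : set 'rV[R]_m)
    (f : 'rV[R]_m -> W) : Prop :=
  (forall x, U x -> {for x, continuous f}) /\
  if k is k'.+1 then
    forall i : 'I_m, (forall x, U x -> derivable f x (delta_mx 0 i)) /\
                     Ck k' U (fun x => 'D_(delta_mx 0 i) f x)
  else True.

Definition smooth_on (W : normedModType R) (U : set 'rV[R]_m)
    (f : 'rV[R]_m -> W) : Prop := forall k, Ck k U f.

Lemma Ck_continuous (W : normedModType R) k U (f : 'rV[R]_m -> W) :
  Ck k U f -> forall x, U x -> {for x, continuous f}.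
Proof. by case: k => [|k] []. Qed.

Lemma CkS (W : normedModType R) k U (f : 'rV[R]_m -> W) :
  Ck k.+1 U f -> Ck k U f.
Proof.
elim: k f => [|k IH] f /= [fc fd]; split => // i.
by have [d1 d2] := fd i; split => //; exact: (IH _ d2).
Qed.

Lemma Ck_ext (W : normedModType R) k U (f g : 'rV[R]_m -> W) : open U ->
  (forall x, U x -> f x = g x) -> Ck k U f -> Ck k U g.
Proof.
move=> oU; elim: k f g => [|k IH] f g fg Cf; have fc := Ck_continuous Cf;
  (have near_fg x : U x -> \forall y \near x, f y = g y by
     move=> Ux; have := open_nbhs_nbhs (conj oU Ux); apply: filterS => y /fg);
  (split => [x Ux|//]; first by
     rewrite /prop_for /continuous_at -(fg _ Ux);
     apply: cvg_trans (fc x Ux); exact: near_eq_cvg (near_fg x Ux)).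
move=> i.
have [_ /(_ i) [d1 d2]] := Cf; split => [x Ux|].
  by apply: near_eq_derivable (near_fg x Ux) _; exact: d1.
apply: IH d2 => x Ux; exact: near_eq_derive (near_fg x Ux).
Qed.

Lemma Ck_cst (W : normedModType R) k U (w : W) :
  open U -> Ck k U (fun _ : 'rV[R]_m => w).
Proof.
move=> oU; elim: k w => [|k IH] w; (split => [x Ux|]; first exact: (@cst_continuous _ _ w)) => //.
move=> i; split => [x Ux|]; first exact: derivable_cst.
by apply: Ck_ext (IH 0) => // x _; rewrite derive_cst.
Qed.

Lemma CkD (W : normedModType R) k U (f g : 'rV[R]_m -> W) : open U ->
  Ck k U f -> Ck k U g -> Ck k U (f + g).
Proof.
move=> oU; elim: k f g => [|k IH] f g Cf Cg;
  (split => [x Ux|//]; first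
     exact: cvgD (Ck_continuous Cf Ux) (Ck_continuous Cg Ux)).
move=> i; have [_ /(_ i) [f1 f2]] := Cf; have [_ /(_ i) [g1 g2]] := Cg.
split => [x Ux|]; first by apply: derivableD; [exact: f1|exact: g1].
apply: Ck_ext (IH _ _ f2 g2) => // x Ux.
by rewrite deriveD //; [exact: f1|exact: g1].
Qed.

Lemma CkM k U (f g : 'rV[R]_m -> R^o) : open U ->
  Ck k U f -> Ck k U g -> Ck k U (f * g).
Proof.
move=> oU; elim: k f g => [|k IH] f g Cf Cg;
  (split => [x Ux|//]; first
     exact: cvgM (Ck_continuous Cf Ux) (Ck_continuous Cg Ux)).
move=> i; have [_ /(_ i) [f1 f2]] := Cf; have [_ /(_ i) [g1 g2]] := Cg.
split => [x Ux|]; first by apply: derivableM; [exact: f1|exact: g1].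
have := CkD oU (IH _ _ (CkS Cf) g2) (IH _ _ (CkS Cg) f2).
apply: Ck_ext => // x Ux.
by rewrite deriveM //; [exact: f1|exact: g1].
Qed.

End SmoothRm.

Record chart (R : realType) (m : nat) (T : topologicalType) := Chart {
  chart_dom : set T;
  chart_map : T -> 'rV[R]_m;
  chart_inv : 'rV[R]_m -> T;
  chart_dom_open : open chart_dom;
  chart_img_open : open (chart_map @` chart_dom);
  chart_mapK : forall x, chart_dom x -> chart_inv (chart_map x) = x;
  chart_map_continuous :
    forall x, chart_dom x -> {for x, continuous chart_map};
  chart_inv_continuous :
    forall y, (chart_map @` chart_dom) y -> {for y, continuous chart_inv} }.

Record manifold (R : realType) (m : nat) := Manifold {
  manifold_sort :> topologicalType;
  manifold_hausdorff : hausdorff_space manifold_sort;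
  manifold_second_countable : @second_countable manifold_sort;
  atlas : set (chart R m manifold_sort);
  atlas_cover : forall x, exists2 c, atlas c & chart_dom c x;
  atlas_compat : forall c c', atlas c -> atlas c' ->
    smooth_on (chart_map c @` (chart_dom c `&` chart_dom c'))
              (chart_map c' \o chart_inv c) }.

Arguments atlas {R m} _ _.

Section SmoothFunctions.
Variables (R : realType) (m : nat) (M : manifold R m).

(* R^o is R as a normed module over itself. *)
Definition is_smooth (f : M -> R^o) : Prop := forall c, atlas M c ->
  smooth_on (chart_map c @` chart_dom c) (f \o chart_inv c).

Definition smooth_pred : {pred M -> R} := mem [set f | is_smooth f].

Record cinf := Cinf { cinf_val :> M -> R; cinfP : cinf_val \in smooth_pred }.

Lemma smooth_subring : subring_closed smooth_pred.
Proof.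
have oc (c : chart R m M) := @chart_img_open R m M c.
have cstP (a : R) : is_smooth (fun _ => a).
  by move=> c _ k; exact: (@Ck_cst _ _ _ _ _ (a : R^o)).
have mulP (f g : M -> R) : is_smooth f -> is_smooth g -> is_smooth (f * g).
  by move=> sf sg c ac k; apply: CkM => //; [exact: sf|exact: sg].
have addP (f g : M -> R) : is_smooth f -> is_smooth g -> is_smooth (f + g).
  by move=> sf sg c ac k; apply: (@CkD R m R^o) => //; [exact: sf|exact: sg].
split; first by rewrite inE; exact: (cstP 1).
  move=> f g; rewrite !inE => sf sg; apply: addP => //.
  have -> : - g = (fun _ => -1) * g.
    by apply/funext => x; rewrite -[LHS]mulN1r.
  exact: mulP.
by move=> f g; rewrite !inE; exact: mulP.
Qed.

HB.instance Definition _ := [isSub of cinf for cinf_val].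
HB.instance Definition _ := [Choice of cinf by <:].
HB.instance Definition _ :=
  GRing.SubChoice_isSubComPzRing.Build (M -> R) smooth_pred cinf smooth_subring.

Lemma smooth_cstP (a : R) : (fun _ : M => a) \in smooth_pred.
Proof.
rewrite inE => c _ k.
exact: (@Ck_cst _ _ _ _ _ (a : R^o) (@chart_img_open R m M c)).
Qed.

Definition smooth_cst (a : R) : cinf := Cinf (smooth_cstP a).

Definition derivation (X : cinf -> cinf^o) : Prop :=
  (forall (a : R) f g,
      X (smooth_cst a * f + g) = smooth_cst a * X f + X g) /\
  (forall f g, X (f * g) = X f * g + f * X g).

Definition derivation_pred : {pred cinf -> cinf^o} :=
  mem [set X | derivation X].

Record vfield := VField {
  vfield_fun :> cinf -> cinf^o; vfieldP : vfield_fun \in derivation_pred }.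

Lemma derivation_submod : submod_closed derivation_pred.
Proof.
split; first by rewrite inE; split=> *; rewrite /= ?(mulr0, mul0r, addr0).
move=> u X Y; rewrite !inE => -[X1 X2] [Y1 Y2]; have E Z : (u *: X + Y) Z = u * X Z + Y Z by [].
split => [a f g|f g]; first by rewrite !E X1 Y1; ring.
by rewrite !E X2 Y2; ring.
Qed.

HB.instance Definition _ := [isSub of vfield for vfield_fun].
HB.instance Definition _ := [Choice of vfield by <:].
HB.instance Definition _ := GRing.SubChoice_isSubLmodule.Build cinf
  (cinf -> cinf^o) derivation_pred vfield derivation_submod.

Lemma bracketP (X Y : vfield) :
  (fun f => X (Y f) - Y (X f) : cinf^o) \in derivation_pred.
Proof.
have [X1 X2] := set_mem (vfieldP X); have [Y1 Y2] := set_mem (vfieldP Y).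
have XD f g : X (f + g) = X f + X g.
  have := X1 1 f g; have -> : smooth_cst 1 = 1 by exact: val_inj.
  by rewrite !mul1r.
have YD f g : Y (f + g) = Y f + Y g.
  have := Y1 1 f g; have -> : smooth_cst 1 = 1 by exact: val_inj.
  by rewrite !mul1r.
rewrite inE; split=> [a f g|f g]; first by rewrite X1 Y1 X1 Y1; ring.
by rewrite X2 Y2 XD YD !X2 !Y2; ring.
Qed.

Definition bracket (X Y : vfield) : vfield := VField (bracketP X Y).

End SmoothFunctions.

Section Tensors.
Variables (R : realType) (m : nat) (M : manifold R m).
Local Notation "'C^oo'" := (cinf M).
Local Notation "'XM'" := (vfield M).
Local Notation "c %:C" := (smooth_cst M c) (at level 1, format "c %:C").

(* The tangent vector at p is the derivation f |-> (X f)(p); tangent vectors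
   live in the real vector space of functionals on C^oo(M). *)
Definition value_at (X : XM) (p : M) : C^oo -> R^o := fun f => X f p.

Definition has_dim (V : lmodType R) (S : set V) (k : nat) : Prop :=
  exists e : 'I_k -> V,
    [/\ forall i, S (e i),
        forall c : 'I_k -> R, \sum_i c i *: e i = 0 -> forall i, c i = 0
      & forall v, S v -> exists c : 'I_k -> R, v = \sum_i c i *: e i].

Definition distribution := M -> set (C^oo -> R^o).

Definition full_distr : distribution := fun p => range (value_at^~ p).

Definition ker_distr (eta : XM -> C^oo) : distribution :=
  fun p => [set value_at X p | X in [set X | eta X p = 0]].

Definition eigen_distr (T : XM -> XM) (a : R) : distribution :=
  fun p => [set value_at X p |
             X in [set X | value_at (T X) p = a *: value_at X p]].

(* A family spanning a k-dimensional subspace of E p on which g is negative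
   definite; its linear independence is implied. *)
Definition neg_definite_family (g : XM -> XM -> C^oo) (E : distribution)
    (p : M) (k : nat) (e : 'I_k -> XM) : Prop :=
  (forall i, E p (value_at (e i) p)) /\
  forall c : 'I_k -> R, (exists i, c i != 0) ->
    let S := \sum_i (c i)%:C *: e i in g S S p < 0.

(* The index of a symmetric bilinear form is the largest dimension of a
   subspace on which it is negative definite. *)
Definition index_at (g : XM -> XM -> C^oo) (E : distribution) (p : M)
    (k : nat) : Prop :=
  (exists e : 'I_k -> XM, neg_definite_family g E p e) /\
  (forall k' (e : 'I_k' -> XM), neg_definite_family g E p e -> (k' <= k)%N).

Definition constant_index (g : XM -> XM -> C^oo) (E : distribution) : Prop :=
  exists k, forall p, index_at g E p k.

Record pseudo_riemannian (g : XM -> XM -> C^oo) : Prop := {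
  metric_linear : forall (f : C^oo) (X Y Z : XM),
    g X (f *: Y + Z) = f * g X Y + g X Z;
  metric_sym : forall X Y : XM, g X Y = g Y X;
  metric_nondegenerate : forall (p : M) (X : XM),
    (forall Y : XM, g X Y p = 0) -> value_at X p = 0;
  metric_index : constant_index g full_distr }.

(* nabla is the Levi-Civita connection of g, characterised as the unique
   torsion-free metric connection. *)
Record levi_civita (g : XM -> XM -> C^oo) (nabla : XM -> XM -> XM) : Prop := {
  conn_linear : forall (f : C^oo) (X Y Z : XM),
    nabla (f *: X + Y) Z = f *: nabla X Z + nabla Y Z;
  conn_add : forall X Y Z : XM, nabla X (Y + Z) = nabla X Y + nabla X Z;
  conn_leibniz : forall (f : C^oo) (X Y : XM),
    nabla X (f *: Y) = (X f : C^oo) *: Y + f *: nabla X Y;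
  conn_torsion_free : forall X Y : XM, nabla X Y - nabla Y X = bracket X Y;
  conn_metric : forall X Y Z : XM,
    X (g Y Z) = g (nabla X Y) Z + g Y (nabla X Z) }.

Definition curvature (nabla : XM -> XM -> XM) (X Y Z : XM) : XM :=
  nabla X (nabla Y Z) - nabla Y (nabla X Z) - nabla (bracket X Y) Z.

(* With the factor 1/2: 2 d eta(X,Y) = X(eta Y) - Y(eta X) - eta [X,Y]. *)
Definition ext_deriv (eta : XM -> C^oo) (X Y : XM) : C^oo :=
  (2^-1)%:C * (X (eta Y) - Y (eta X) - eta (bracket X Y)).

(* The Lie derivative L_xi T of a (1,1)-tensor field T. *)
Definition lie_endo (xi : XM) (T : XM -> XM) (X : XM) : XM :=
  bracket xi (T X) - T (bracket xi X).

Definition tensor_h (phi : XM -> XM) (xi : XM) (X : XM) : XM :=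
  (2^-1)%:C *: lie_endo xi phi X.

End Tensors.

Section Paracontact.
Variables (R : realType) (n : nat) (M : manifold R n.*2.+1).
Local Notation "'C^oo'" := (cinf M).
Local Notation "'XM'" := (vfield M).
Local Notation "c %:C" := (smooth_cst M c) (at level 1, format "c %:C").

Record almost_paracontact (phi : XM -> XM) (xi : XM) (eta : XM -> C^oo) :
    Prop := {
  phi_linear : forall (f : C^oo) (X Y : XM), phi (f *: X + Y) = f *: phi X + phi Y;
  eta_linear : forall (f : C^oo) (X Y : XM), eta (f *: X + Y) = f * eta X + eta Y;
  eta_xi : eta xi = 1;
  phi_sqr : forall X : XM, phi (phi X) = X - eta X *: xi;
  phi_eigen_pos : forall p,
    has_dim (ker_distr eta p `&` eigen_distr phi 1 p) n;
  phi_eigen_neg : forall p,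
    has_dim (ker_distr eta p `&` eigen_distr phi (-1) p) n }.

Record paracontact_metric (phi : XM -> XM) (xi : XM) (eta : XM -> C^oo)
    (g : XM -> XM -> C^oo) : Prop := {
  pcm_almost_paracontact : almost_paracontact phi xi eta;
  pcm_metric : pseudo_riemannian g;
  pcm_compatible : forall X Y : XM, g (phi X) (phi Y) = - g X Y + eta X * eta Y;
  pcm_contact : forall X Y : XM, ext_deriv eta X Y = g X (phi Y) }.

Definition kappa_mu_condition (phi : XM -> XM) (xi : XM) (eta : XM -> C^oo)
    (nabla : XM -> XM -> XM) (kappa mu : R) : Prop :=
  let h := tensor_h phi xi in
  forall X Y : XM, curvature nabla X Y xi =
    kappa%:C *: (eta Y *: X - eta X *: Y) +
    mu%:C *: (eta Y *: h X - eta X *: h Y).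

End Paracontact.

(* Main.v *)
Require Import Defs.
From HB Require Import structures.
From mathcomp Require Import all_boot all_order all_algebra.
From mathcomp Require Import all_classical all_reals.
From mathcomp Require Import topology normedtype derive.
From mathcomp Require Import ring lra.
Set Implicit Arguments.
Unset Strict Implicit.
Unset Printing Implicit Defensive.
Import Order.TTheory GRing.Theory Num.Theory.
Import numFieldNormedType.Exports.
Local Open Scope classical_set_scope.
Local Open Scope ring_scope.

(** Write nabla_X xi = S X - phi X. The contact condition says exactly that the
    skew part of nabla xi is - phi, so S is symmetric. The first Bianchi
    identity, contracted with xi, makes the cyclic sum of nabla phi vanish
    ([T_cyclic]); from this S anticommutes with phi, nabla_xi phi = 0 and
    h = phi S. The part of the nullity condition on R(X, xi) xi that commutes
    with phi then gives S^2 = - (1 + kappa) phi^2 ([S_sqr]).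

    The nullity condition on the remaining R(X, Y) xi is a Codazzi equation
    relating nabla phi to nabla S ([codazzi]). Together with the symmetries
    inherited from the algebra of phi and S it determines both covariant
    derivatives completely. Indeed, subtract from nabla phi and nabla S their
    expected values, getting trilinear forms [tau] and [sigma]. They are killed
    by xi and satisfy only homogeneous identities. These force tau (h Z, X, Y)
    to vanish ([quasi_parallel_form_eq0]), hence tau = 0 since h is invertible
    on the horizontal vectors when kappa + 1 is nonzero; sigma is then totally
    symmetric and changes sign when S moves between its last two slots, hence
    sigma = 0 ([codazzi_anticommuting_form_eq0]).

    Knowing nabla phi and nabla S, the Ricci identities compute the commutators
    of every curvature operator R(X, Y) with phi and S ([ricci_phi],
    [ricci_S]). The right-hand side of the theorem, [model_curvature], is an
    algebraic curvature tensor with the same commutators and the same values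
    on xi. The difference U is therefore an algebraic curvature tensor whose
    operators commute with both phi and S. Such a U vanishes: on horizontal
    vectors S = phi h has two eigenspaces, which are orthogonal and exchanged
    by phi; the operators U(X, Y) preserve them, so U(X_+, Y_-) = 0 by pair
    symmetry, then U(X_+, Y_+) Z_- = 0 by the Bianchi identity, and phi
    transports this to U(X_+, Y_+) Z_+ = 0. The lemma [curvature_form_eq0] is a
    version of this argument without eigenvectors. *)

(** * Multilinear forms with too many symmetries *)

Section TensorSymmetries.
Variables (K : realFieldType) (V : Type) (phi S : V -> V).

(** tau stands for the covariant derivative of phi, as the form
    (X, Y, Z) |-> g ((nabla_X phi) Y, Z), and sigma for that of S. Since phi
    slides between the last two slots of tau, cyclicity lets it slide between all
    three. The Codazzi equation at (X, Y, Z) is then combined, with suitable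
    signs, with the three obtained by applying phi to two of the arguments: the
    terms in sigma cancel up to values of tau, and cyclicity collects what
    remains into a multiple of tau (phi (S Z)) X Y. *)
Lemma quasi_parallel_form_eq0 (tau sigma : V -> V -> V -> K) :
  (forall X Y Z, tau X Y Z = - tau X Z Y) ->
  (forall X Y Z, tau X Y Z + tau Y Z X + tau Z X Y = 0) ->
  (forall X Y Z, tau X (phi Y) Z = tau X Y (phi Z)) ->
  (forall X Y Z, tau X Y (phi (phi Z)) = tau X Y Z) ->
  (forall X Y Z, tau X Y (S (phi Z)) = - tau X Y (phi (S Z))) ->
  (forall X Y Z, sigma X Y Z = sigma X Z Y) ->
  (forall X Y Z, sigma X Y (phi (phi Z)) = sigma X Y Z) ->
  (forall X Y Z, tau Z X Y = sigma Y X Z - sigma X Y Z) ->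
  (forall X Y Z, sigma X (phi Y) Z
     = sigma X Y (phi Z) - tau X Y (S Z) - tau X (S Y) Z) ->
  forall X Y Z, tau (phi (S Z)) X Y = 0.
Proof.
move=> tskew tcyc tphi tphi2 tanti ssym sphi2 codazzi sphi.
have tau1 X Y Z : tau (phi X) Y Z = tau X Y (phi Z).
  have := tcyc (phi X) Y Z; have := tcyc X (phi Y) Z; have := tcyc X Y (phi Z).
  have := tcyc (phi X) (phi Y) (phi Z); rewrite ?(tphi, tphi2); lra.
move=> X Y Z.
have := codazzi X Y Z; have := codazzi (phi X) (phi Y) Z.
have := codazzi (phi X) Y (phi Z); have := codazzi X (phi Y) (phi Z).
have := sphi X Y (phi Z); have := sphi Y X (phi Z).
have := sphi (phi X) Y Z; have := sphi (phi Y) X Z.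
rewrite ?(sphi2, tphi, tphi2, tau1, tanti).
have := tcyc X Y (phi (S Z)); rewrite tau1 (tskew Y _ X).
rewrite (tskew X (S Y)) (tskew Y (S X)).
rewrite (ssym (phi X) (phi Y)) (ssym (phi Y) (phi X)).
lra.
Qed.

(** S moves from the second slot to the third with one change of sign; by total
    symmetry it can also go there through the first slot, with two changes. *)
Lemma codazzi_anticommuting_form_eq0 (sigma : V -> V -> V -> K) :
  (forall X Y Z, sigma X Y Z = sigma X Z Y) ->
  (forall X Y Z, sigma X Y Z = sigma Y X Z) ->
  (forall X Y Z, sigma X (S Y) Z = - sigma X Y (S Z)) ->
  forall X Y Z, sigma X Y (S Z) = 0.
Proof.
move=> sym23 sym12 anti X Y Z.
have E : sigma X (S Y) Z = sigma X Y (S Z).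
  rewrite (sym12 X) (sym23 (S Y)) (sym12 (S Y)) anti.
  by rewrite (sym12 Z) (sym23 Y Z) anti opprK (sym12 Y).
by have := anti X Y Z; rewrite E; lra.
Qed.

(** Bianchi identities with S placed in each of the four slots make S slide
    between the two pairs of slots, not only inside each pair; S then both commutes
    and anticommutes with phi inside U. *)
Lemma curvature_form_eq0 (U : V -> V -> V -> V -> K) :
  (forall X Y Z W, U X Y Z W = - U Y X Z W) ->
  (forall X Y Z W, U X Y Z W = U Z W X Y) ->
  (forall X Y Z W, U X Y Z W + U Y Z X W + U Z X Y W = 0) ->
  (forall X Y Z W, U X Y (S Z) W = U X Y Z (S W)) ->
  (forall X Y Z W, U X Y (phi Z) W = - U X Y Z (phi W)) ->
  (forall X Y Z W, U X Y Z (S (phi W)) = - U X Y Z (phi (S W))) ->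
  forall X Y Z W, U X Y Z (S (phi W)) = 0.
Proof.
move=> skew pair bianchi slide phiU anti.
have slide1 X Y Z W : U (S X) Y Z W = U X (S Y) Z W.
  by rewrite !(pair _ _ Z W) slide.
have slide13 X Y Z W : U (S X) Y Z W = U X Y Z (S W).
  have := bianchi X Y Z (S W); have := bianchi (S X) Y Z W.
  have := bianchi X (S Y) Z W; have := bianchi X Y (S Z) W.
  rewrite !slide -!slide1; lra.
move=> X Y Z W.
have := slide13 X Y (phi Z) W; rewrite !phiU slide13 anti; lra.
Qed.

End TensorSymmetries.

(** Proves an equation as a consequence of another one with the same
    difference of sides, leaving an identity for [ring]. *)
Lemma eq_from_sub (V : zmodType) (a b c d : V) : a = b -> c - d = a - b -> c = d.
Proof. by move=> -> E; apply/subr0_eq; rewrite E subrr. Qed.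

(** * Functions, derivations and brackets *)

Section SmoothCalculus.
Variables (R : realType) (m : nat) (M : manifold R m).
Local Notation "'C^oo'" := (cinf M).
Local Notation "'XM'" := (vfield M).
Local Notation "c %:C" := (smooth_cst M c) (at level 1, format "c %:C").
Implicit Types (f : C^oo) (X Y Z : XM) (p : M).

Lemma cinf_eq f1 f2 : (forall p, f1 p = f2 p) -> f1 = f2.
Proof. by move=> E; apply/val_inj/funext. Qed.

Lemma cinfD f1 f2 p : (f1 + f2) p = f1 p + f2 p. Proof. by []. Qed.
Lemma cinfM f1 f2 p : (f1 * f2) p = f1 p * f2 p. Proof. by []. Qed.
Lemma cinfN f p : (- f) p = - f p. Proof. by []. Qed.
Lemma cinf0 p : (0 : C^oo) p = 0. Proof. by []. Qed.
Lemma cinf1 p : (1 : C^oo) p = 1. Proof. by []. Qed.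
Lemma cinf_cst (a : R) p : a%:C p = a. Proof. by []. Qed.
Definition cinfE := (cinfD, cinfM, cinfN, cinf0, cinf1, cinf_cst).

Lemma cst1 : 1%:C = 1 :> C^oo. Proof. exact: val_inj. Qed.

(** The ring of smooth functions has zero divisors, and is zero on an empty
    manifold; cancellation in it is done pointwise. *)
Lemma double_cinf_eq0 f : f + f = 0 -> f = 0.
Proof.
move=> E; apply: cinf_eq => p; have : (f + f) p = 0 by rewrite E.
by rewrite !cinfE; lra.
Qed.

Lemma sqr_cinf_eq0 f : f * f = 0 -> f = 0.
Proof.
move=> E; apply: cinf_eq => p; have : (f * f) p = 0 by rewrite E.
by rewrite !cinfE => /eqP; rewrite mulf_eq0 orbb => /eqP.
Qed.

Lemma vfield_eq X Y : (forall f, X f = Y f) -> X = Y.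
Proof. by move=> E; apply/val_inj/funext. Qed.

Lemma vfield_addE X Y f : (X + Y) f = X f + Y f :> C^oo. Proof. by []. Qed.
Lemma vfield_oppE X f : (- X) f = - X f :> C^oo. Proof. by []. Qed.
Lemma bracketE X Y f : bracket X Y f = X (Y f) - Y (X f) :> C^oo. Proof. by []. Qed.

Lemma vfield_leibniz X f1 f2 : X (f1 * f2) = X f1 * f2 + f1 * X f2 :> C^oo.
Proof. by have [_ E] := set_mem (vfieldP X); apply: E. Qed.

Lemma vfieldD X f1 f2 : X (f1 + f2) = X f1 + X f2 :> C^oo.
Proof.
have [E _] := set_mem (vfieldP X).
by have := E 1 f1 f2; rewrite cst1 !mul1r.
Qed.

Lemma vfield0 X : X 0 = 0 :> C^oo.
Proof. by apply: (addrI (X 0)); rewrite -vfieldD !addr0. Qed.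

Lemma vfieldN X f : X (- f) = - X f :> C^oo.
Proof.
by apply/eqP; rewrite -addr_eq0 -vfieldD addNr vfield0.
Qed.

Lemma vfield1 X : X 1 = 0 :> C^oo.
Proof.
apply: (addrI (X 1)); rewrite addr0 -[in RHS](mulr1 1) vfield_leibniz.
by rewrite mulr1 mul1r.
Qed.

Lemma vfield_cst X (a : R) : X a%:C = 0 :> C^oo.
Proof.
have [E _] := set_mem (vfieldP X).
by have := E a 1 0; rewrite mulr1 !addr0 vfield1 vfield0 mulr0 addr0.
Qed.

Lemma bracketC X Y : bracket X Y = - bracket Y X.
Proof. by apply: vfield_eq => f; rewrite vfield_oppE !bracketE opprB. Qed.

Lemma jacobi X Y Z : bracket X (bracket Y Z) + bracket Y (bracket Z X)
  + bracket Z (bracket X Y) = 0.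
Proof.
apply: vfield_eq => f; rewrite !vfield_addE !bracketE !(vfieldD, vfieldN).
transitivity (0 : C^oo); [ring | by []].
Qed.

End SmoothCalculus.

(** * Metric, connection and curvature *)

Section LeviCivita.
Variables (R : realType) (m : nat) (M : manifold R m).
Local Notation "'C^oo'" := (cinf M).
Local Notation "'XM'" := (vfield M).
Variables (g : XM -> XM -> C^oo) (nabla : XM -> XM -> XM).
Hypotheses (Hg : pseudo_riemannian g) (Hnabla : levi_civita g nabla).
Implicit Types (f : C^oo) (X Y Z W : XM) (p : M).

Let gC := Defs.metric_sym Hg.

Lemma metricDr X Y Z : g X (Y + Z) = g X Y + g X Z.
Proof. by rewrite -[Y]scale1r (metric_linear Hg) mul1r scale1r. Qed.

Lemma metric0r X : g X 0 = 0.
Proof. by apply: (addrI (g X 0)); rewrite -metricDr !addr0. Qed.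

Lemma metricZr f X Y : g X (f *: Y) = f * g X Y.
Proof. by rewrite -[f *: Y]addr0 (metric_linear Hg) metric0r addr0. Qed.

Lemma metricNr X Y : g X (- Y) = - g X Y.
Proof. by rewrite -scaleN1r metricZr mulN1r. Qed.

Lemma metricDl X Y Z : g (X + Y) Z = g X Z + g Y Z.
Proof. by rewrite !(gC _ Z) metricDr. Qed.
Lemma metric0l X : g 0 X = 0. Proof. by rewrite gC metric0r. Qed.
Lemma metricZl f X Y : g (f *: X) Y = f * g X Y.
Proof. by rewrite !(gC _ Y) metricZr. Qed.
Lemma metricNl X Y : g (- X) Y = - g X Y.
Proof. by rewrite !(gC _ Y) metricNr. Qed.

Definition metricE := (metricDl, metricDr, metricNl, metricNr,
  metricZl, metricZr, metric0l, metric0r).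

Lemma metric_inj X Y : (forall Z, g X Z = g Y Z) -> X = Y.
Proof.
move=> E; apply/subr0_eq/vfield_eq => f; apply: cinf_eq => p.
have : value_at (X - Y) p = 0.
  apply: (metric_nondegenerate Hg) => Z.
  by rewrite metricDl metricNl E subrr.
by move/(congr1 (fun v => v f)).
Qed.

Lemma nablaDr X Y Z : nabla X (Y + Z) = nabla X Y + nabla X Z.
Proof. exact: conn_add Hnabla _ _ _. Qed.
Lemma nabla0r X : nabla X 0 = 0.
Proof. by apply: (addrI (nabla X 0)); rewrite -nablaDr !addr0. Qed.
Lemma nablaNr X Y : nabla X (- Y) = - nabla X Y.
Proof.
by apply/eqP; rewrite -addr_eq0 -nablaDr addNr nabla0r.
Qed.
Lemma nablaDl X Y Z : nabla (X + Y) Z = nabla X Z + nabla Y Z.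
Proof. by rewrite -[X]scale1r (conn_linear Hnabla) !scale1r. Qed.
Lemma nabla0l X : nabla 0 X = 0.
Proof. by apply: (addrI (nabla 0 X)); rewrite -nablaDl !addr0. Qed.
Lemma nablaZl f X Y : nabla (f *: X) Y = f *: nabla X Y.
Proof. by rewrite -[f *: X]addr0 (conn_linear Hnabla) nabla0l addr0. Qed.
Lemma nablaNl X Y : nabla (- X) Y = - nabla X Y.
Proof. by rewrite -scaleN1r nablaZl scaleN1r. Qed.

Definition riemann X Y Z W : C^oo := g (curvature nabla X Y Z) W.

Lemma riemann_skew12 X Y Z W : riemann X Y Z W = - riemann Y X Z W.
Proof.
by rewrite /riemann /curvature (bracketC X Y) nablaNl !metricE; ring.
Qed.

Lemma curvature_bianchi X Y Z :
  curvature nabla X Y Z + curvature nabla Y Z X + curvature nabla Z X Y = 0.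
Proof.
rewrite /curvature.
have J A B D : bracket A (bracket B D)
    = nabla A (nabla B D) - nabla A (nabla D B) - nabla (bracket B D) A.
  by rewrite -nablaNr -nablaDr !(conn_torsion_free Hnabla).
rewrite -[RHS](jacobi X Y Z) !J.
apply: metric_inj => W; rewrite !metricE; ring.
Qed.

Lemma riemann_bianchi X Y Z W :
  riemann X Y Z W + riemann Y Z X W + riemann Z X Y W = 0.
Proof. by rewrite /riemann -!metricDl curvature_bianchi metric0l. Qed.

Lemma riemann_linear4 f X Y Z W W' :
  riemann X Y Z (f *: W + W') = f * riemann X Y Z W + riemann X Y Z W'.
Proof. by rewrite /riemann metricDr metricZr. Qed.

Lemma riemann_skew34 X Y Z W : riemann X Y Z W = - riemann X Y W Z.
Proof.
apply/eqP; rewrite -addr_eq0; apply/eqP.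
rewrite /riemann /curvature !metricE.
have P (A B D : XM) : A (g B D) = g (nabla A B) D + g B (nabla A D).
  exact: conn_metric Hnabla _ _ _.
have E : bracket X Y (g Z W) = X (Y (g Z W)) - Y (X (g Z W)) by [].
rewrite !P !vfieldD !P in E.
rewrite !(gC _ Z); apply: (eq_from_sub (esym E)); ring.
Qed.

(** The octahedron argument: pair symmetry is a linear combination of the four
    Bianchi identities on X, Y, Z, W and the two skew symmetries. *)
Lemma riemann_pair X Y Z W : riemann X Y Z W = riemann Z W X Y.
Proof.
apply: cinf_eq => p.
have L A B D E : riemann A B D E p + riemann B D A E p + riemann D A B E p = 0.
  by rewrite -!cinfD riemann_bianchi.
have S12 A B D E : riemann A B D E p = - riemann B A D E p.
  by rewrite riemann_skew12.
have S34 A B D E : riemann A B D E p = - riemann A B E D p.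
  by rewrite riemann_skew34.
have := L X Y Z W; have := L Y Z W X; have := L Z W X Y; have := L W X Y Z.
rewrite (S34 X Y W Z) (S34 Y Z W X) (S34 Z W Y X) (S12 W Y Z X).
rewrite (S12 W X Z Y) (S34 X W Z Y) (S12 X Z W Y) (S34 Z X W Y).
rewrite (S12 W X Y Z) (S34 Y W X Z); lra.
Qed.

End LeviCivita.

(** * Paracontact metric structures *)

Section Paracontact.
Variables (R : realType) (n : nat) (M : manifold R n.*2.+1).
Local Notation "'C^oo'" := (cinf M).
Local Notation "'XM'" := (vfield M).
Local Notation "c %:C" := (smooth_cst M c) (at level 1, format "c %:C").
Variables (phi : XM -> XM) (xi : XM) (eta : XM -> C^oo) (g : XM -> XM -> C^oo).
Variable nabla : XM -> XM -> XM.
Hypotheses (Hpcm : paracontact_metric phi xi eta g) (Hnabla : levi_civita g nabla).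
Implicit Types (f : C^oo) (X Y Z W : XM) (p : M).

Let Hapc : almost_paracontact phi xi eta := pcm_almost_paracontact Hpcm.
Let Hg : pseudo_riemannian g := pcm_metric Hpcm.
Let gC := Defs.metric_sym Hg.
Let gE := metricE Hg.
Let ext := metric_inj Hg.

Lemma phiD X Y : phi (X + Y) = phi X + phi Y.
Proof. by rewrite -[X]scale1r (phi_linear Hapc) !scale1r. Qed.
Lemma phi0 : phi 0 = 0.
Proof. by apply: (addrI (phi 0)); rewrite -phiD !addr0. Qed.
Lemma phiZ f X : phi (f *: X) = f *: phi X.
Proof. by rewrite -[f *: X]addr0 (phi_linear Hapc) phi0 addr0. Qed.
Lemma phiN X : phi (- X) = - phi X.
Proof. by rewrite -scaleN1r phiZ scaleN1r. Qed.

Lemma etaD X Y : eta (X + Y) = eta X + eta Y.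
Proof. by rewrite -[X]scale1r (eta_linear Hapc) mul1r scale1r. Qed.
Lemma eta0 : eta 0 = 0.
Proof. by apply: (addrI (eta 0)); rewrite -etaD !addr0. Qed.
Lemma etaZ f X : eta (f *: X) = f * eta X.
Proof. by rewrite -[f *: X]addr0 (eta_linear Hapc) eta0 addr0. Qed.
Lemma etaN X : eta (- X) = - eta X.
Proof. by rewrite -scaleN1r etaZ mulN1r. Qed.

(** The structure equation applied to phi xi shows phi xi = a xi, and then
    0 = phi^2 xi = a^2 xi, where smooth functions have no nilpotents. *)
Lemma phi_xi : phi xi = 0.
Proof.
have phi2 : phi (phi xi) = 0.
  by rewrite (phi_sqr Hapc) (eta_xi Hapc) scale1r subrr.
have phi1 : phi xi = eta (phi xi) *: xi.
  by apply/subr0_eq; rewrite -(phi_sqr Hapc) phi2 phi0.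
have eta0' : eta (phi xi) = 0.
  apply: sqr_cinf_eq0; have := congr1 eta phi2.
  by rewrite {1}phi1 phiZ etaZ eta0.
by rewrite phi1 eta0' scale0r.
Qed.

Lemma eta_phi X : eta (phi X) = 0.
Proof.
have : phi (phi (phi X)) = phi X - eta X *: phi xi.
  by rewrite (phi_sqr Hapc X) phiD phiN phiZ.
rewrite (phi_sqr Hapc (phi X)) phi_xi scaler0 => /addrI/oppr_inj/(congr1 eta).
by rewrite etaZ (eta_xi Hapc) mulr1 eta0.
Qed.

Lemma metric_xir X : g X xi = eta X.
Proof.
apply/esym/subr0_eq; rewrite -(metric0r Hg (phi X)) -phi_xi (pcm_compatible Hpcm).
by rewrite (eta_xi Hapc) mulr1 addrC.
Qed.

Lemma metric_xil X : g xi X = eta X.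
Proof. by rewrite gC metric_xir. Qed.

Lemma metric_phir X Y : g X (phi Y) = - g (phi X) Y.
Proof.
have := pcm_compatible Hpcm X (phi Y); rewrite (phi_sqr Hapc) eta_phi !gE.
by rewrite metric_xir eta_phi !mulr0 oppr0 !addr0 => ->; rewrite opprK.
Qed.

(** S, T = nabla phi and N = nabla S are kept as variables known only through
    the equations that define them, so that rewriting with linearity lemmas
    never looks inside them. *)
Variables (S : XM -> XM) (T N : XM -> XM -> XM).
Hypothesis nabla_xi : forall X, nabla X xi = S X - phi X.
Hypothesis nabla_phi : forall X Y, nabla X (phi Y) = T X Y + phi (nabla X Y).
Hypothesis nabla_S : forall X Y, nabla X (S Y) = N X Y + S (nabla X Y).

Lemma SE X : S X = nabla X xi + phi X.
Proof. by rewrite nabla_xi subrK. Qed.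
Lemma SD X Y : S (X + Y) = S X + S Y.
Proof. by rewrite !SE (nablaDl Hnabla) phiD addrACA. Qed.
Lemma SZ f X : S (f *: X) = f *: S X.
Proof. by rewrite !SE (nablaZl Hnabla) phiZ scalerDr. Qed.
Lemma SN X : S (- X) = - S X.
Proof. by rewrite -scaleN1r SZ scaleN1r. Qed.
Lemma S0 : S 0 = 0.
Proof. by have := SZ 0 0; rewrite !scale0r. Qed.

Lemma vf_metric (X Y Z : XM) :
  X (g Y Z) = g (nabla X Y) Z + g Y (nabla X Z) :> C^oo.
Proof. exact: conn_metric Hnabla _ _ _. Qed.

(** This is the contact condition: d eta (X, Y) is the skew part of
    g (nabla_X xi, Y), so what remains of nabla xi is symmetric. *)
Lemma metric_Sr X Y : g X (S Y) = g (S X) Y.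
Proof.
have := pcm_contact Hpcm X Y; rewrite /ext_deriv -!metric_xir !vf_metric.
rewrite -(conn_torsion_free Hnabla) !nabla_xi !gE (gC Y (S X)) (gC Y (phi X)).
rewrite !metric_phir => E; apply: cinf_eq => p.
have := congr1 (fun u : C^oo => u p) E; rewrite !cinfE.
lra.
Qed.

Lemma eta_S X : eta (S X) = 0.
Proof.
have := vf_metric X xi xi; rewrite nabla_xi !gE metric_xir (eta_xi Hapc) vfield1.
rewrite !metric_xir !metric_xil !eta_phi !oppr0 !addr0.
by move/esym/double_cinf_eq0.
Qed.

Lemma S_xi : S xi = 0.
Proof. by apply: ext => Z; rewrite -metric_Sr metric_xil eta_S !gE. Qed.

Lemma vf_eta (X Y : XM) :
  X (eta Y) = eta (nabla X Y) + g (S X) Y - g (phi X) Y :> C^oo.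
Proof.
by rewrite -metric_xir vf_metric nabla_xi metric_xir !gE !(gC Y) addrA.
Qed.

Lemma T_skew X Y Z : g (T X Y) Z = - g (T X Z) Y.
Proof.
have E : X (g (phi Y) Z) = - X (g Y (phi Z)) by rewrite metric_phir vfieldN opprK.
move: E; rewrite !vf_metric !nabla_phi !gE !metric_phir (gC Y (T X Z)) => E.
by apply: (eq_from_sub E); ring.
Qed.

Lemma N_sym X Y Z : g (N X Y) Z = g (N X Z) Y.
Proof.
have E : X (g (S Y) Z) = X (g Y (S Z)) by rewrite metric_Sr.
move: E; rewrite !vf_metric !nabla_S !gE !metric_Sr (gC Y (N X Z)) => E.
by apply: (eq_from_sub E); ring.
Qed.

(** The derivative of phi^2 = I - eta xi. *)
Lemma T_phi X Y : T X (phi Y) =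
  - phi (T X Y) - (g (S X) Y - g (phi X) Y) *: xi - eta Y *: (S X - phi X).
Proof.
have : nabla X (phi (phi Y)) = nabla X (Y - eta Y *: xi) by rewrite (phi_sqr Hapc).
rewrite !nabla_phi (nablaDr Hnabla) (nablaNr Hnabla) (conn_leibniz Hnabla).
rewrite nabla_xi vf_eta phiD (phi_sqr Hapc) => E; apply: ext => Z.
have := congr1 (g ^~ Z) E; rewrite !gE => {}E; apply: (eq_from_sub E); ring.
Qed.

Lemma T_xi X : T X xi = - phi (S X) + X - eta X *: xi.
Proof.
have := nabla_phi X xi; rewrite phi_xi (nabla0r Hnabla) nabla_xi phiD phiN.
rewrite (phi_sqr Hapc) => E; apply: ext => Z.
have := congr1 (g ^~ Z) E; rewrite !gE => {}E; apply: (eq_from_sub (esym E)); ring.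
Qed.

Lemma N_xi X : N X xi = - S (S X) + S (phi X).
Proof.
have := nabla_S X xi; rewrite S_xi (nabla0r Hnabla) nabla_xi SD SN => E.
apply: ext => Z; have := congr1 (g ^~ Z) E; rewrite !gE => {}E.
by apply: (eq_from_sub (esym E)); ring.
Qed.

Lemma curvature_xi X Y :
  curvature nabla X Y xi = N X Y - N Y X - (T X Y - T Y X).
Proof.
rewrite /curvature !nabla_xi !(nablaDr Hnabla) !(nablaNr Hnabla) !nabla_S
  !nabla_phi.
rewrite -(conn_torsion_free Hnabla) SD SN phiD phiN.
by apply: ext => Z; rewrite !gE; ring.
Qed.

Local Notation Riem := (riemann g nabla).

Lemma riemann_xi X Y Z : Riem X Y xi Z
  = g (N X Y) Z - g (N Y X) Z - (g (T X Y) Z - g (T Y X) Z).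
Proof. by rewrite /riemann curvature_xi !gE. Qed.

(** Closedness of the fundamental form g (X, phi Y). It is read off from the
    Bianchi identity, since the skew part of nabla_X (nabla xi) is - nabla_X phi
    and the symmetric part cancels in the cyclic sum. *)
Lemma T_cyclic X Y Z : g (T X Y) Z + g (T Y Z) X + g (T Z X) Y = 0.
Proof.
have E : Riem X Y xi Z + Riem Y Z xi X + Riem Z X xi Y = 0.
  rewrite !(riemann_skew34 Hg Hnabla _ _ xi) -!opprD.
  by rewrite (riemann_bianchi Hg Hnabla) oppr0.
apply: double_cinf_eq0; move: E; rewrite !riemann_xi.
rewrite (N_sym X Z) (N_sym Y X) (N_sym Z Y) (T_skew X Z) (T_skew Y X) (T_skew Z Y).
move=> E; rewrite -[RHS]oppr0 -E; ring.
Qed.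

(** [riemann_xi], with cyclicity gathering its two derivatives of phi into one:
    the direction of differentiation becomes the third argument Z. *)
Lemma codazzi X Y Z : Riem X Y xi Z = g (T Z X) Y + g (N X Y) Z - g (N Y X) Z.
Proof.
rewrite riemann_xi (T_skew Y X Z); apply: (eq_from_sub (esym (T_cyclic X Y Z))).
ring.
Qed.

Lemma double_metric_inj X Y : (forall Z, g X Z + g X Z = g Y Z + g Y Z) -> X = Y.
Proof.
move=> E; apply: ext => Z; apply/subr0_eq/double_cinf_eq0.
by rewrite addrACA E -opprD subrr.
Qed.

Lemma phi2_S X : phi (phi (S X)) = S X.
Proof. by rewrite (phi_sqr Hapc) eta_S scale0r subr0. Qed.

Lemma S_phi2 X : S (phi (phi X)) = S X.
Proof. by rewrite (phi_sqr Hapc) SD SN SZ S_xi scaler0 oppr0 addr0. Qed.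

(** [T_cyclic] with one argument equal to xi expresses nabla_xi phi as minus
    the anticommutator of S and phi. But nabla_xi phi anticommutes with phi,
    because phi^2 is parallel along xi, and the anticommutator commutes with
    phi: both vanish. *)
Lemma S_phi X : S (phi X) = - phi (S X).
Proof.
have Txi Y : T xi Y = - phi (S Y) - S (phi Y).
  apply: ext => Z; rewrite !gE.
  have := T_cyclic xi Y Z; rewrite (T_skew Y Z) !T_xi !gE.
  rewrite (gC (phi (S Z))) metric_phir metric_Sr (gC Z Y) !metric_xil => E.
  by apply: (eq_from_sub E); ring.
have E : phi (S (phi X)) = - S X.
  apply: double_metric_inj => Z; have := congr1 (g ^~ Z) (T_phi xi X).
  rewrite !Txi S_xi phi_xi phiD !phiN phi2_S S_phi2 !gE => {}E.
  by apply: (eq_from_sub (esym E)); ring.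
have := congr1 phi E; rewrite (phi_sqr Hapc) eta_S scale0r subr0 => ->.
by rewrite phiN.
Qed.

Lemma T_xil X : T xi X = 0.
Proof.
apply: ext => Z; rewrite !gE.
have := T_cyclic xi X Z; rewrite (T_skew X Z) !T_xi !gE.
rewrite (gC (phi (S Z))) metric_phir metric_Sr S_phi (gC Z X) !metric_xil !gE => E.
by apply: (eq_from_sub E); ring.
Qed.

Lemma tensor_hE X : tensor_h phi xi X = phi (S X).
Proof.
have E : lie_endo xi phi X = phi (S X) + phi (S X).
  rewrite /lie_endo -!(conn_torsion_free Hnabla) nabla_phi T_xil !nabla_xi.
  rewrite S_phi !phiD !phiN.
  by apply: ext => Z; rewrite !phiD !phiN !gE; ring.
by apply: ext => Z; apply: cinf_eq => p; rewrite /tensor_h E !gE !cinfE; lra.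
Qed.

Lemma N_phi X Y : N X (phi Y) = - T X (S Y) - phi (N X Y) - S (T X Y).
Proof.
have := nabla_S X (phi Y); rewrite S_phi (nablaNr Hnabla) !nabla_phi !nabla_S.
rewrite SD S_phi phiD => E; apply: ext => Z.
have := congr1 (g ^~ Z) E; rewrite !gE => {}E.
by apply: (eq_from_sub (esym E)); ring.
Qed.

Variables kappa mu : R.
Hypothesis Hkm : kappa_mu_condition phi xi eta nabla kappa mu.
Local Notation k := (kappa%:C).
Local Notation m := (mu%:C).

Lemma N_xil X :
  N xi X = - S (S X) - (1 + k) *: (X - eta X *: xi) - m *: phi (S X).
Proof.
have := Hkm X xi; rewrite curvature_xi T_xil T_xi N_xi !tensor_hE S_xi phi0.
rewrite S_phi (eta_xi Hapc) => E; apply: ext => Z.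
have := congr1 (g ^~ Z) E; rewrite !gE => {}E.
by apply: (eq_from_sub (esym E)); ring.
Qed.

(** By [N_xil], S^2 + (1 + kappa) phi^2 = - (nabla_xi S + mu h). The left
    side commutes with phi; the right side anticommutes with it, since
    nabla_xi phi = 0. So both sides are zero. *)
Lemma S_sqr X : S (S X) = - (1 + k) *: (X - eta X *: xi).
Proof.
have E : phi (S (S X)) = - (1 + k) *: phi X.
  apply: double_metric_inj => Z; have := congr1 (g ^~ Z) (N_phi xi X).
  rewrite !T_xil !N_xil !S_phi !SN !S_phi !phiD !phiN !phiZ phi2_S S0 eta_phi.
  rewrite !phiD !phiN !phiZ phi_xi !gE => {}E.
  by apply: (eq_from_sub (esym E)); ring.
by rewrite -phi2_S E phiZ (phi_sqr Hapc).
Qed.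

Lemma phiS_sym X Y : g (phi (S X)) Y = g (phi (S Y)) X.
Proof. by rewrite gC metric_phir metric_Sr S_phi !gE opprK. Qed.

Lemma metric_S_sym X Y : g (S X) Y = g (S Y) X.
Proof. by rewrite gC metric_Sr. Qed.

Lemma metric_phi_skew X Y : g (phi X) Y = - g (phi Y) X.
Proof. by rewrite gC metric_phir. Qed.

(** The derivative of S^2 = - (1 + kappa) phi^2. *)
Lemma N_S X Y : N X (S Y) = - S (N X Y)
  + (1 + k) *: ((g (S X) Y - g (phi X) Y) *: xi + eta Y *: (S X - phi X)).
Proof.
have cst : X (- (1 + k)) = 0 :> C^oo.
  by rewrite vfieldN vfieldD vfield1 vfield_cst addr0 oppr0.
have := nabla_S X (S Y); rewrite S_sqr (conn_leibniz Hnabla) cst scale0r add0r.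
rewrite (nablaDr Hnabla) (nablaNr Hnabla) (conn_leibniz Hnabla) vf_eta nabla_xi.
rewrite nabla_S SD S_sqr => E; apply: ext => Z.
have := congr1 (g ^~ Z) E; rewrite !gE => {}E.
by apply: (eq_from_sub (esym E)); ring.
Qed.

(** The defect of nabla phi from its expected value
    (nabla_X phi) Y = eta (Y) (X - h X) - g (X - h X, Y) xi. *)
Definition tau X Y Z : C^oo := g (T X Y) Z
  - eta Y * (g X Z - g (phi (S X)) Z) + eta Z * (g X Y - g (phi (S X)) Y).

(** The defect of nabla S from its expected value
    (nabla_X S) Y = eta (Y) Q X + g (Q X, Y) xi - mu eta (X) h Y, where
    Q = (1 + kappa) phi^2 - h. *)
Definition sigma X Y Z : C^oo := g (N X Y) Z
  - eta Y * ((1 + k) * (g X Z - eta X * eta Z) - g (phi (S X)) Z)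
  - eta Z * ((1 + k) * (g X Y - eta X * eta Y) - g (phi (S X)) Y)
  + m * eta X * g (phi (S Y)) Z.

Lemma tau_skew X Y Z : tau X Y Z = - tau X Z Y.
Proof. by rewrite /tau (T_skew X Y Z); ring. Qed.

Lemma tau_cyclic X Y Z : tau X Y Z + tau Y Z X + tau Z X Y = 0.
Proof.
rewrite /tau (phiS_sym Y X) (phiS_sym Z) (phiS_sym Z) (gC Y X) (gC Z X) (gC Z Y).
by apply: (eq_from_sub (T_cyclic X Y Z)); ring.
Qed.

Lemma tau_phi X Y Z : tau X (phi Y) Z = tau X Y (phi Z).
Proof.
rewrite /tau T_phi !gE !metric_phir phi2_S !eta_phi metric_xil; ring.
Qed.

Lemma tau_xi X Y : tau X Y xi = 0.
Proof.
rewrite /tau T_skew T_xi !gE !metric_xir eta_phi (eta_xi Hapc) metric_xil; ring.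
Qed.

Lemma tauDr X Y Z W : tau X Y (Z + W) = tau X Y Z + tau X Y W.
Proof. by rewrite /tau !gE etaD; ring. Qed.
Lemma tauZr f X Y Z : tau X Y (f *: Z) = f * tau X Y Z.
Proof. by rewrite /tau !gE etaZ; ring. Qed.
Lemma tauNr X Y Z : tau X Y (- Z) = - tau X Y Z.
Proof. by rewrite /tau !gE etaN; ring. Qed.

Lemma tau_phi2 X Y Z : tau X Y (phi (phi Z)) = tau X Y Z.
Proof. by rewrite (phi_sqr Hapc) tauDr tauNr tauZr tau_xi mulr0 oppr0 addr0. Qed.

Lemma sigma_sym X Y Z : sigma X Y Z = sigma X Z Y.
Proof. by rewrite /sigma (N_sym X Y Z) (phiS_sym Y Z); ring. Qed.

Lemma sigma_xi X Y : sigma X Y xi = 0.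
Proof.
rewrite /sigma N_sym N_xi !gE !metric_xir !eta_phi (eta_xi Hapc) S_phi S_sqr.
by rewrite !gE metric_xil; ring.
Qed.

Lemma sigmaDr X Y Z W : sigma X Y (Z + W) = sigma X Y Z + sigma X Y W.
Proof. by rewrite /sigma !gE etaD; ring. Qed.
Lemma sigmaZr f X Y Z : sigma X Y (f *: Z) = f * sigma X Y Z.
Proof. by rewrite /sigma !gE etaZ; ring. Qed.
Lemma sigmaNr X Y Z : sigma X Y (- Z) = - sigma X Y Z.
Proof. by rewrite /sigma !gE etaN; ring. Qed.

Lemma sigma_phi2 X Y Z : sigma X Y (phi (phi Z)) = sigma X Y Z.
Proof.
by rewrite (phi_sqr Hapc) sigmaDr sigmaNr sigmaZr sigma_xi mulr0 oppr0 addr0.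
Qed.

Lemma riemann_xi_km X Y Z : Riem X Y xi Z = k * (eta Y * g X Z - eta X * g Y Z)
  + m * (eta Y * g (phi (S X)) Z - eta X * g (phi (S Y)) Z).
Proof. by rewrite /riemann Hkm !tensor_hE !gE. Qed.

Lemma tau_codazzi X Y Z : tau Z X Y = sigma Y X Z - sigma X Y Z.
Proof.
rewrite /sigma /tau.
have := codazzi X Y Z; rewrite riemann_xi_km => E; apply: (eq_from_sub (esym E)).
rewrite (phiS_sym Y X) (phiS_sym Z X) (phiS_sym Z Y) (gC Y X) (gC Z X) (gC Z Y).
ring.
Qed.

Lemma sigma_phi X Y Z :
  sigma X (phi Y) Z = sigma X Y (phi Z) - tau X Y (S Z) - tau X (S Y) Z.
Proof.
rewrite /sigma /tau N_phi !gE !metric_phir !metric_Sr phi2_S !eta_phi !eta_S.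
rewrite !S_phi !phiN !S_sqr !phiZ !phiD !phiN !phiZ phi_xi !phi2_S !gE.
ring.
Qed.

Lemma sigma_S X Y Z : sigma X (S Y) Z = - sigma X Y (S Z).
Proof.
rewrite /sigma N_S !gE !metric_Sr metric_xil !eta_S.
rewrite !S_phi !S_sqr !phiZ !phiD !phiN !phiZ phi_xi !gE.
ring.
Qed.

Hypothesis kappa_neq : kappa + 1 != 0.

Lemma cancel_kappa f : (1 + k) * f = 0 -> f = 0.
Proof.
move=> E; apply: cinf_eq => p; have : ((1 + k) * f) p = 0 by rewrite E.
by rewrite !cinfE => /eqP; rewrite mulf_eq0 addrC (negbTE kappa_neq) => /eqP.
Qed.

Lemma TDl X Y Z : T (X + Y) Z = T X Z + T Y Z.
Proof.
apply: (addIr (phi (nabla (X + Y) Z))); rewrite -nabla_phi.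
by rewrite !(nablaDl Hnabla) phiD !nabla_phi addrACA.
Qed.

Lemma TZl f X Y : T (f *: X) Y = f *: T X Y.
Proof.
apply: (addIr (phi (nabla (f *: X) Y))); rewrite -nabla_phi.
by rewrite !(nablaZl Hnabla) phiZ nabla_phi scalerDr.
Qed.

Lemma tauDl X Y Z W : tau (X + Y) Z W = tau X Z W + tau Y Z W.
Proof. by rewrite /tau TDl SD phiD !gE; ring. Qed.
Lemma tauZl f X Y Z : tau (f *: X) Y Z = f * tau X Y Z.
Proof. by rewrite /tau TZl SZ phiZ !gE; ring. Qed.
Lemma tau_xil X Y : tau xi X Y = 0.
Proof. by rewrite /tau T_xil S_xi phi0 !gE !metric_xil; ring. Qed.

(** h^2 = (1 + kappa) phi^2, the invertibility of h on horizontal vectors. *)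
Lemma phiS_sqr X : phi (S (phi (S X))) = (1 + k) *: X + (- (1 + k) * eta X) *: xi.
Proof.
rewrite S_phi !phiN S_sqr !phiZ phiD phiN phiZ phi_xi scaler0 oppr0 addr0.
by rewrite (phi_sqr Hapc); apply: ext => W; rewrite !gE; ring.
Qed.

Lemma tau_eq0 X Y Z : tau X Y Z = 0.
Proof.
have tau0 A B D : tau (phi (S A)) B D = 0.
  apply: cinf_eq => p; rewrite cinf0.
  apply: (@quasi_parallel_form_eq0 R XM phi S (fun X Y Z => tau X Y Z p)
    (fun X Y Z => sigma X Y Z p)) => *.
  - by rewrite tau_skew.
  - by rewrite -!cinfD tau_cyclic.
  - by rewrite tau_phi.
  - by rewrite tau_phi2.
  - by rewrite S_phi tauNr.
  - by rewrite sigma_sym.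
  - by rewrite sigma_phi2.
  - by rewrite tau_codazzi.
  - by rewrite sigma_phi.
apply: cancel_kappa; have := tau0 (phi (S X)) Y Z.
by rewrite phiS_sqr tauDl !tauZl tau_xil mulr0 addr0.
Qed.

(** Once tau vanishes, [tau_codazzi] is the missing symmetry of sigma. *)
Lemma sigma_eq0 X Y Z : sigma X Y Z = 0.
Proof.
have sigma0 A B D : sigma A B (S D) = 0.
  apply: cinf_eq => p; rewrite cinf0.
  apply: (@codazzi_anticommuting_form_eq0 R XM S (fun X Y Z => sigma X Y Z p)) => *.
  - by rewrite sigma_sym.
  - by congr (cinf_val _ p); apply/esym/subr0_eq; rewrite -tau_codazzi tau_eq0.
  - by rewrite sigma_S.
apply: cancel_kappa; have := sigma0 X Y (S Z); rewrite S_sqr sigmaZr sigmaDr.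
rewrite sigmaNr sigmaZr sigma_xi mulr0 oppr0 addr0 mulNr => /eqP.
by rewrite oppr_eq0 => /eqP.
Qed.

Lemma T_formula X Y Z : g (T X Y) Z =
  eta Y * (g X Z - g (phi (S X)) Z) - eta Z * (g X Y - g (phi (S X)) Y).
Proof. by apply: (eq_from_sub (tau_eq0 X Y Z)); rewrite /tau; ring. Qed.

Lemma N_formula X Y Z : g (N X Y) Z =
  eta Y * ((1 + k) * (g X Z - eta X * eta Z) - g (phi (S X)) Z)
  + eta Z * ((1 + k) * (g X Y - eta X * eta Y) - g (phi (S X)) Y)
  - m * eta X * g (phi (S Y)) Z.
Proof. by apply: (eq_from_sub (sigma_eq0 X Y Z)); rewrite /sigma; ring. Qed.

Lemma eta_nabla X Y : eta Y = 0 -> eta (nabla X Y) = g (phi X) Y - g (S X) Y.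
Proof.
move=> Y0; have := vf_eta X Y; rewrite Y0 vfield0 => E.
by apply: (eq_from_sub (esym E)); ring.
Qed.

Lemma metric_nabla X Y Z : g (nabla X Y) Z = X (g Y Z) - g Y (nabla X Z) :> C^oo.
Proof. by rewrite vf_metric addrK. Qed.

(** The Ricci identity for phi: differentiate [T_formula] once more and
    skew-symmetrize. On horizontal Z and W only the derivatives of eta
    contribute. *)
Lemma ricci_phi X Y Z W : eta Z = 0 -> eta W = 0 ->
  Riem X Y (phi Z) W = - Riem X Y Z (phi W)
   + (g (S X) Z - g (phi X) Z) * (g Y W - g (phi (S Y)) W)
   - (g (S Y) Z - g (phi Y) Z) * (g X W - g (phi (S X)) W)
   - (g Y Z - g (phi (S Y)) Z) * (g (S X) W - g (phi X) W)
   + (g X Z - g (phi (S X)) Z) * (g (S Y) W - g (phi Y) W).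
Proof.
move=> Z0 W0.
have T0 A : g (T A Z) W = 0 by rewrite T_formula Z0 W0; ring.
rewrite /riemann metric_phir opprK /curvature !nabla_phi !(nablaDr Hnabla).
rewrite !nabla_phi !phiD !phiN !gE !(metric_nabla _ (T _ _)) !T0.
rewrite !vfield0 !T_formula !eta_nabla // Z0 W0; ring.
Qed.

(** The Ricci identity for S. Besides the derivatives of eta in the xi-terms of
    [N_formula], the term - mu eta (X) h Y contributes - 2 mu d eta (X, Y) h; the
    contributions of nabla h itself are symmetric in X and Y and cancel. *)
Lemma ricci_S X Y Z W : eta Z = 0 -> eta W = 0 ->
  Riem X Y (S Z) W = Riem X Y Z (S W)
   + (g (S X) Z - g (phi X) Z) * ((1 + k) * g Y W - g (phi (S Y)) W)
   - (g (S Y) Z - g (phi Y) Z) * ((1 + k) * g X W - g (phi (S X)) W)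
   + ((1 + k) * g Y Z - g (phi (S Y)) Z) * (g (S X) W - g (phi X) W)
   - ((1 + k) * g X Z - g (phi (S X)) Z) * (g (S Y) W - g (phi Y) W)
   + (m + m) * g (phi X) Y * g (phi (S Z)) W.
Proof.
move=> Z0 W0.
have N0 A : g (N A Z) W = - m * eta A * g (phi (S Z)) W.
  by rewrite N_formula Z0 W0; ring.
rewrite /riemann metric_Sr /curvature !nabla_S !(nablaDr Hnabla) !nabla_S.
rewrite !SD !SN !gE !(metric_nabla _ (N _ _)) !N0.
have dG (A : XM) : A (g (phi (S Z)) W) = m * eta A * g (phi (S Z)) (phi W)
    + g (phi (S (nabla A Z))) W + g (phi (S Z)) (nabla A W) :> C^oo.
  rewrite vf_metric nabla_phi nabla_S phiD !gE T_formula eta_S W0.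
  have -> : g (phi (N A Z)) W = - g (N A Z) (phi W) by rewrite metric_phir opprK.
  by rewrite N_formula Z0 eta_phi; ring.
rewrite !vfield_leibniz !vfieldN !vfield_cst !vf_eta !dG !N_formula.
rewrite -(conn_torsion_free Hnabla) etaD etaN ?(Z0, W0).
rewrite !(eta_nabla _ Z0) !(eta_nabla _ W0).
rewrite (metric_S_sym Y X) (metric_phi_skew Y X); ring.
Qed.

Local Notation h := (tensor_h phi xi).

Definition model_curvature X Y Z W p : R :=
    (-1 + mu / 2) * (g Y Z p * g X W p - g X Z p * g Y W p)
  + g Y Z p * g (h X) W p - g X Z p * g (h Y) W p
  - g Y W p * g (h X) Z p + g X W p * g (h Y) Z p
  + (-1 + mu / 2) / (kappa + 1) *
      (g (h Y) Z p * g (h X) W p - g (h X) Z p * g (h Y) W p)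
  - mu / 2 * (g (phi Y) Z p * g (phi X) W p - g (phi X) Z p * g (phi Y) W p)
  + (- kappa - mu / 2) / (kappa + 1) *
      (g (phi (h Y)) Z p * g (phi (h X)) W p
       - g (phi (h Y)) W p * g (phi (h X)) Z p)
  + mu * (g (phi X) Y p * g (phi Z) W p)
  + eta X p * eta W p *
      ((kappa + 1 - mu / 2) * g Y Z p + (mu - 1) * g (h Y) Z p)
  - eta X p * eta Z p *
      ((kappa + 1 - mu / 2) * g Y W p + (mu - 1) * g (h Y) W p)
  + eta Y p * eta Z p *
      ((kappa + 1 - mu / 2) * g X W p + (mu - 1) * g (h X) W p)
  - eta Y p * eta W p *
      ((kappa + 1 - mu / 2) * g X Z p + (mu - 1) * g (h X) Z p).

Local Notation mc := model_curvature.

Lemma model_skew X Y Z W p : mc X Y Z W p = - mc Y X Z W p.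
Proof.
rewrite /mc !tensor_hE !phi2_S (metric_phi_skew Y X) !cinfE; ring.
Qed.

Lemma model_pair X Y Z W p : mc X Y Z W p = mc Z W X Y p.
Proof.
rewrite /mc !tensor_hE !phi2_S.
rewrite (phiS_sym Z X) (phiS_sym Z Y) (phiS_sym W X) (phiS_sym W Y).
rewrite (metric_S_sym Z X) (metric_S_sym Z Y) (metric_S_sym W X) (metric_S_sym W Y).
rewrite (metric_phi_skew Z X) (metric_phi_skew Z Y) (metric_phi_skew W X).
rewrite (metric_phi_skew W Y) (gC Z X) (gC Z Y) (gC W X) (gC W Y) !cinfE; ring.
Qed.

Lemma model_bianchi X Y Z W p : mc X Y Z W p + mc Y Z X W p + mc Z X Y W p = 0.
Proof.
rewrite /mc !tensor_hE !phi2_S.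
rewrite (phiS_sym Y X) (phiS_sym Z X) (phiS_sym Z Y).
rewrite (metric_S_sym Y X) (metric_S_sym Z X) (metric_S_sym Z Y).
rewrite (metric_phi_skew Y X) (metric_phi_skew Z X) (metric_phi_skew Z Y).
rewrite (gC Y X) (gC Z X) (gC Z Y) !cinfE; by field.
Qed.

Lemma model_xi X Y W p : mc X Y xi W p = Riem X Y xi W p.
Proof.
rewrite riemann_xi_km /mc !tensor_hE !phi2_S !metric_xir phi_xi !eta_phi.
rewrite !eta_S (eta_xi Hapc) !gE !cinfE.
by field.
Qed.

Lemma model_linear X Y Z f W W' p :
  mc X Y Z (f *: W + W') p = f p * mc X Y Z W p + mc X Y Z W' p.
Proof.
by rewrite /mc !tensor_hE !phi2_S !gE etaD etaZ !cinfE; ring.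
Qed.

(** Both curvatures have the same commutator with phi, hence their difference
    commutes with phi; similarly for S in [model_S]. *)
Lemma model_phi X Y Z W p : eta Z = 0 -> eta W = 0 ->
  Riem X Y (phi Z) W p - mc X Y (phi Z) W p
  = - (Riem X Y Z (phi W) p - mc X Y Z (phi W) p).
Proof.
move=> Z0 W0; rewrite ricci_phi // /mc !tensor_hE !phi2_S !eta_phi Z0 W0.
rewrite !metric_phir !phi2_S !(phi_sqr Hapc) !gE !metric_xil ?(Z0, W0) !cinfE.
by field.
Qed.

Lemma model_S X Y Z W p : eta Z = 0 -> eta W = 0 ->
  Riem X Y (S Z) W p - mc X Y (S Z) W p
  = Riem X Y Z (S W) p - mc X Y Z (S W) p.
Proof.
move=> Z0 W0; rewrite ricci_S // /mc !tensor_hE !phi2_S !eta_S Z0 W0.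
rewrite !metric_Sr !S_phi !S_sqr !phiZ !phiD !phiN !phiZ phi_xi.
rewrite !gE !metric_xil ?(Z0, W0) !cinfE.
by field.
Qed.

Lemma phi3 X : phi (phi (phi X)) = phi X.
Proof. by rewrite (phi_sqr Hapc) eta_phi scale0r subr0. Qed.

(** The commutator identities are known on horizontal arguments only, but U
    ignores the xi-components of all its arguments, so they hold everywhere. *)
Lemma curvature_eq_model X Y Z W p : Riem X Y Z W p = mc X Y Z W p.
Proof.
pose U X Y Z W := Riem X Y Z W p - mc X Y Z W p.
have Uskew A B D E : U A B D E = - U B A D E.
  by rewrite /U (riemann_skew12 Hg Hnabla) model_skew !cinfE; ring.
have Upair A B D E : U A B D E = U D E A B.
  by rewrite /U (riemann_pair Hg Hnabla) model_pair.
have Ubianchi A B D E : U A B D E + U B D A E + U D A B E = 0.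
  have := model_bianchi A B D E p; have : (0 : C^oo) p = 0 by [].
  by rewrite -(riemann_bianchi Hg Hnabla A B D E) /U !cinfE; lra.
have Ulin A B D f E E' : U A B D (f *: E + E') = f p * U A B D E + U A B D E'.
  by rewrite /U (riemann_linear4 nabla Hg) model_linear !cinfE; ring.
have U0 A B D : U A B D 0 = 0.
  have := Ulin A B D 1 0 0; rewrite scale1r addr0 cinf1; lra.
have Uneg A B D E : U A B D (- E) = - U A B D E.
  by have := Ulin A B D (-1) E 0; rewrite scaleN1r addr0 U0 !cinfE mulN1r addr0.
have Uxi3 A B E : U A B xi E = 0 by rewrite /U model_xi subrr.
have Uskew34 A B D E : U A B D E = - U A B E D.
  by rewrite Upair Uskew Upair.
have Uxi4 A B D : U A B D xi = 0 by rewrite Uskew34 Uxi3 oppr0.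
have Uhor4 A B D E : U A B D (phi (phi E)) = U A B D E.
  by rewrite (phi_sqr Hapc) addrC -scaleNr Ulin Uxi4 mulr0 add0r.
have Uhor3 A B D E : U A B (phi (phi D)) E = U A B D E.
  by rewrite Uskew34 Uhor4 -Uskew34.
have U_S A B D E : U A B (S D) E = U A B D (S E).
  rewrite -(S_phi2 D) -[LHS]Uhor4 [LHS]model_S ?eta_phi //.
  by rewrite -/(U _ _ _ _) S_phi2 Uhor3.
have U_phi A B D E : U A B (phi D) E = - U A B D (phi E).
  rewrite -(phi3 D) -[LHS]Uhor4 [LHS]model_phi ?eta_phi //.
  by rewrite -/(U _ _ _ _) phi3 Uhor3.
have U_anti A B D E : U A B D (S (phi E)) = - U A B D (phi (S E)).
  by rewrite S_phi Uneg.
have UZ A B D f E : U A B D (f *: E) = f p * U A B D E.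
  by rewrite -[f *: E]addr0 Ulin U0 addr0.
apply/subr0_eq; rewrite -/(U X Y Z W) -Uhor4.
(* phi (S W) is chosen because S phi (phi (S W)) = S^2 W, and S^2 is invertible on
   horizontal vectors. *)
have := curvature_form_eq0 Uskew Upair Ubianchi U_S U_phi U_anti X Y Z (phi (S W)).
rewrite phi2_S S_sqr -(phi_sqr Hapc) UZ !cinfE => /eqP.
by rewrite mulf_eq0 oppr_eq0 addrC (negbTE kappa_neq) => /eqP.
Qed.

End Paracontact.

Theorem corollary5p9 (R : realType) (n : nat) (M : manifold R n.*2.+1)
  (phi : vfield M -> vfield M) (xi : vfield M) (eta : vfield M -> cinf M)
  (g : vfield M -> vfield M -> cinf M)
  (nabla : vfield M -> vfield M -> vfield M) (kappa mu : R)
  (Hpcm : paracontact_metric phi xi eta g)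
  (Hnabla : levi_civita g nabla)
  (Hkm : kappa_mu_condition phi xi eta nabla kappa mu)
  (Hkappa : kappa < -1)
  (Hindex_pos : constant_index g
     (eigen_distr (phi \o tensor_h phi xi) (Num.sqrt (-1 - kappa))))
  (Hindex_neg : constant_index g
     (eigen_distr (phi \o tensor_h phi xi) (- Num.sqrt (-1 - kappa)))) :
  let h := tensor_h phi xi in
  forall (X Y Z W : vfield M) (p : M),
  g (curvature nabla X Y Z) W p =
    (-1 + mu / 2) * (g Y Z p * g X W p - g X Z p * g Y W p)
  + g Y Z p * g (h X) W p - g X Z p * g (h Y) W p
  - g Y W p * g (h X) Z p + g X W p * g (h Y) Z p
  + (-1 + mu / 2) / (kappa + 1) *
      (g (h Y) Z p * g (h X) W p - g (h X) Z p * g (h Y) W p)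
  - mu / 2 * (g (phi Y) Z p * g (phi X) W p - g (phi X) Z p * g (phi Y) W p)
  + (- kappa - mu / 2) / (kappa + 1) *
      (g (phi (h Y)) Z p * g (phi (h X)) W p
       - g (phi (h Y)) W p * g (phi (h X)) Z p)
  + mu * (g (phi X) Y p * g (phi Z) W p)
  + eta X p * eta W p *
      ((kappa + 1 - mu / 2) * g Y Z p + (mu - 1) * g (h Y) Z p)
  - eta X p * eta Z p *
      ((kappa + 1 - mu / 2) * g Y W p + (mu - 1) * g (h Y) W p)
  + eta Y p * eta Z p *
      ((kappa + 1 - mu / 2) * g X W p + (mu - 1) * g (h X) W p)
  - eta Y p * eta W p *
      ((kappa + 1 - mu / 2) * g X Z p + (mu - 1) * g (h X) Z p).
Proof.
have kappa_neq : kappa + 1 != 0 by rewrite lt_eqF //; lra.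
have nxi X : nabla X xi = (nabla X xi + phi X) - phi X by rewrite addrK.
have nphi X Y :
    nabla X (phi Y) = (nabla X (phi Y) - phi (nabla X Y)) + phi (nabla X Y).
  by rewrite subrK.
pose S X := nabla X xi + phi X.
have nS X Y : nabla X (S Y) = (nabla X (S Y) - S (nabla X Y)) + S (nabla X Y).
  by rewrite subrK.
move=> h X Y Z W p.
exact: (curvature_eq_model Hpcm Hnabla nxi nphi nS Hkm kappa_neq).
Qed.
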